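(* For every integer $n\ge 0$, $$R_2(0,3,3n+2)\equiv R_2(1,3,3n+2)\equiv R_2(2,3,3n+2)\pmod 3.$$
   Context: An overpartition of $n$ is a partition of $n$ in which the first occurrence of each number may be overlined; there is exactly one overpartition of $0$ (the empty one). An overpartition pair of $n$ is an ordered pair $\pi=(\lambda,\mu)$ of overpartitions such that the sum of all parts of $\lambda$ and $\mu$ is $n$ (either may be the overpartition of $0$). For an overpartition $\lambda$, $n_2(\lambda)$ denotes the number of overlined parts of $\lambda$. For an overpartition pair $\pi=(\lambda,\mu)$, define $r_2(\pi)=n_2(\lambda)-n_2(\mu)$ (so the empty pair of $0$ has $r_2=0$). $R_2(s,t,n)$ is the number of overpartition pairs $\pi$ of $n$ with $r_2(\pi)\equiv s\pmod t$. *)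

(* Defs.v *)
From HB Require Import structures.
From mathcomp Require Import all_boot all_order all_algebra.
Set Implicit Arguments.
Unset Strict Implicit.
Unset Printing Implicit Defensive.

(* The entry (k, b) of a list is a part of size k, overlined iff b holds.
   Parts are listed in weakly decreasing order of size, and a part that repeats
   the size of its predecessor is not overlined; hence only the first
   occurrence of each size can be overlined. *)
Definition part_next (x y : nat * bool) : bool :=
  (y.1 < x.1) || ((y.1 == x.1) && ~~ y.2).

Definition is_overpartition (l : seq (nat * bool)) : bool :=
  all (fun x => 0 < x.1) l && sorted part_next l.

Definition weight (l : seq (nat * bool)) : nat := \sum_(x <- l) x.1.

Definition n2 (l : seq (nat * bool)) : nat := count snd l.

Definition is_overpartition_pair (n : nat)
    (p : seq (nat * bool) * seq (nat * bool)) : bool :=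
  [&& is_overpartition p.1, is_overpartition p.2
    & weight p.1 + weight p.2 == n].

Record overpartition_pair (n : nat) := OverpartitionPair {
  opair :> seq (nat * bool) * seq (nat * bool);
  _ : is_overpartition_pair n opair
}.

HB.instance Definition _ n := [isSub for @opair n].
HB.instance Definition _ n := [Countable of overpartition_pair n by <:].

(* Finiteness: the parts are positive, so both lists have at most n entries,
   each of size at most n. *)
Section Finiteness.
Variable n : nat.

Let bounded : Type := (n.-bseq ('I_n.+1 * bool))%type.

Let enc (l : seq (nat * bool)) : bounded :=
  insub_bseq n [seq (inord x.1, x.2) | x <- l].

Let dec (b : bounded) : seq (nat * bool) :=
  [seq (nat_of_ord x.1, x.2) | x <- b].

Let size_weight l : is_overpartition l -> size l <= weight l.
Proof.
rewrite /weight; case/andP=> + _.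
elim: l => [|x l IHl] //= /andP[x_gt0 /IHl le_l].
by rewrite big_cons -add1n leq_add.
Qed.

Let part_weight l x : x \in l -> x.1 <= weight l.
Proof. by move=> lx; rewrite /weight (big_rem x lx) leq_addr. Qed.

Let encK l : is_overpartition l -> weight l <= n -> dec (enc l) = l.
Proof.
move=> ol wl; rewrite /dec /enc /insub_bseq val_insubd size_map.
rewrite (leq_trans (size_weight ol) wl) -map_comp -[RHS]map_id.
apply/eq_in_map => x lx /=; rewrite inordK; first by case: x {lx}.
by rewrite ltnS (leq_trans (part_weight lx) wl).
Qed.

Let enc_pair (p : overpartition_pair n) : bounded * bounded :=
  (enc (opair p).1, enc (opair p).2).

Let dec_pair (b : bounded * bounded) : option (overpartition_pair n) :=
  insub (dec b.1, dec b.2).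

Lemma enc_pairK : pcancel enc_pair dec_pair.
Proof.
case=> [[l m] p_lm]; rewrite /dec_pair /enc_pair /=.
have /and3P[/= ol om /eqP def_n] := p_lm.
rewrite !encK //; first by rewrite (insubT (is_overpartition_pair n) p_lm).
  by rewrite -def_n leq_addl.
by rewrite -def_n leq_addr.
Qed.

HB.instance Definition _ : isFinite (overpartition_pair n) :=
  PCanIsFinite enc_pairK.

End Finiteness.

Definition r2 (p : seq (nat * bool) * seq (nat * bool)) : int :=
  ((n2 p.1)%:Z - (n2 p.2)%:Z)%R.

Definition R2 (s t : int) (n : nat) : nat :=
  #|[set p : overpartition_pair n | (r2 p == s %[mod t])%Z]|.

(* Main.v *)
Require Import Defs.
From HB Require Import structures.
From mathcomp Require Import all_boot all_order all_algebra.
From mathcomp Require Import ring zify.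

Set Implicit Arguments.
Unset Strict Implicit.
Unset Printing Implicit Defensive.

Import GRing.Theory.

(** Exchanging the two components of a pair negates [r2], so the residue
    classes 1 and 2 have equally many pairs.  Hence the total number of pairs
    of [n] is [R2 0 3 n + 2 * R2 1 3 n], which is [R2 0 3 n - R2 1 3 n] modulo
    3, and everything reduces to one divisibility: 3 divides the number of all
    overpartition pairs of [n] when [n] is 2 modulo 3
    ([card_overpartition_pair_mod3]).

    Let P be the generating function of overpartitions, the product of the
    (1 + X^k) / (1 - X^k); pairs have generating function P^2.  Gauss's identity
    says that 1 / P is the theta series S = 1 + 2 sum_(s >= 1) (-1)^s X^(s^2).
    Over the field with three elements, P^2 = P^3 S, where P^3 only involves
    exponents divisible by 3 and S only involves squares, which are 0 or 1
    modulo 3.  So P^2 has no exponent equal to 2 modulo 3.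

    Power series are replaced by polynomials modulo [X^M].  Gauss's identity is
    obtained from a finite identity in the style of Shanks ([finite_gauss]),
    which needs no passage to the limit: it is exact, with an error term
    divisible by a high power of X.  The product formula for P comes from a
    recurrence on a bound for the parts ([belowS]). *)

(** * A finite form of Gauss's identity *)

Section Gauss.
Local Open Scope ring_scope.
Variables (R : comNzRingType) (q : R).

Definition qpoch_minus (n : nat) : R := \prod_(k < n) (1 - q ^+ k.+1).
Definition qpoch_plus (n : nat) : R := \prod_(k < n) (1 + q ^+ k.+1).
Definition theta (n : nat) : R :=
  1 + (\sum_(s < n) (-1) ^+ s.+1 * q ^+ (s.+1 ^ 2)) *+ 2.

(** The defect of Gauss's identity for the partial products of length [n].
    Divided by [qpoch_plus n], its terms are the corrections
    (-1)^s q^(s(n+1)) (P_n / P_s) / (1 + q^s) of Shanks's identity, with P_n the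
    quotient of [qpoch_minus n] by [qpoch_plus n]; multiplying out makes the
    identity valid in any commutative ring. *)
Definition theta_error (n : nat) : R :=
  \sum_(s < n) (-1) ^+ s.+1 * q ^+ (s.+1 * n.+1) * qpoch_plus s
     * \prod_(s.+1 <= k < n) (1 - q ^+ k.+1).

Lemma qpoch_minusS n : qpoch_minus n.+1 = qpoch_minus n * (1 - q ^+ n.+1).
Proof. by rewrite /qpoch_minus big_ord_recr. Qed.

Lemma qpoch_plusS n : qpoch_plus n.+1 = qpoch_plus n * (1 + q ^+ n.+1).
Proof. by rewrite /qpoch_plus big_ord_recr. Qed.

(** The summand of index [s], passing from [n] to [n + 1], changes by a factor
    [1 + q ^+ n.+1] up to a difference [h s.+1 - h s], so the sum telescopes and
    only the end terms of [h] remain. *)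
Lemma theta_errorS n :
  theta_error n.+1 = (1 + q ^+ n.+1) * theta_error n + q ^+ n.+1 * qpoch_minus n
    + (-1) ^+ n.+1 * q ^+ (n.+1 ^ 2) * qpoch_plus n.+1.
Proof.
pose h s := (-1) ^+ s.+1 * q ^+ (s.+1 * n.+1) * qpoch_plus s
              * \prod_(s <= k < n) (1 - q ^+ k.+1).
have step (s : 'I_n) :
    (-1) ^+ s.+1 * q ^+ (s.+1 * n.+2) * qpoch_plus s
      * \prod_(s.+1 <= k < n.+1) (1 - q ^+ k.+1)
    = (1 + q ^+ n.+1) * ((-1) ^+ s.+1 * q ^+ (s.+1 * n.+1) * qpoch_plus s
      * \prod_(s.+1 <= k < n) (1 - q ^+ k.+1)) + (h s.+1 - h s).
  rewrite /h big_nat_recr //= [\prod_(s <= k < n) _]big_ltn // qpoch_plusS.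
  rewrite !mulSn [(s * n.+2)%N]mulnS !exprD ![_ ^+ _.+1]exprS.
  by ring.
rewrite {1}/theta_error big_ord_recr /= (eq_bigr _ (fun s _ => step s)).
rewrite big_split /= -mulr_sumr -/(theta_error n).
rewrite -(big_mkord xpredT (fun s => h s.+1 - h s)) telescope_sumr //.
rewrite /h [X in _ * X - _]big_geq // big_mkord /= -/(qpoch_minus n) qpoch_plusS.
have -> : qpoch_plus 0 = 1 by rewrite /qpoch_plus big_ord0.
rewrite mul1n [(n.+1 * n.+2)%N]mulnS exprD -mulnn big_geq //.
by ring.
Qed.

(** By induction on [n]: the term of [theta] that appears is exactly what
    the recurrence for the error term produces. *)
Lemma finite_gauss n :
  qpoch_plus n * theta n = qpoch_minus n + theta_error n *+ 2.
Proof.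
elim: n => [|n IHn].
  by rewrite /qpoch_plus /theta /qpoch_minus /theta_error !big_ord0; ring.
have -> : theta n.+1 = theta n + ((-1) ^+ n.+1 * q ^+ (n.+1 ^ 2)) *+ 2.
  by rewrite /theta big_ord_recr mulrnDl addrA.
rewrite mulrDr {1}qpoch_plusS mulrAC IHn theta_errorS qpoch_minusS.
by ring.
Qed.

(** Each summand of the error term contains the power [q ^+ (s.+1 * n.+1)], so
    the finite products agree with the theta series up to order [n]. *)
Lemma gauss_mod n :
  exists c, qpoch_plus n * theta n = qpoch_minus n + c * q ^+ n.+1.
Proof.
exists ((\sum_(s < n) (-1) ^+ s.+1 * q ^+ (s * n.+1) * qpoch_plus s
     * \prod_(s.+1 <= k < n) (1 - q ^+ k.+1)) *+ 2).
rewrite finite_gauss mulrnAl mulr_suml; congr (_ + _ *+ 2).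
by apply: eq_bigr => s _; rewrite mulSn exprD; ring.
Qed.

End Gauss.

(** * Counting overpartitions with bounded parts *)

(** Overpartitions are obtained from the pairs with an empty second
    component, which spares a separate finiteness argument. *)
Definition overpartitions (n : nat) : seq (seq (nat * bool)) :=
  [seq (opair p).1 | p <- enum {: overpartition_pair n} & (opair p).2 == [::]].

Lemma mem_overpartitions n l :
  (l \in overpartitions n) = is_overpartition l && (weight l == n).
Proof.
have w0 : weight [::] = 0 by rewrite /weight big_nil.
apply/mapP/andP => [[[[l1 l2] pP]]|[ol wl]].
  rewrite mem_filter /= => /andP[/eqP l20 _] ->; subst l2.
  by have /and3P[/= -> _] := pP; rewrite w0 addn0.
have pP : is_overpartition_pair n (l, [::]).
  by rewrite /is_overpartition_pair /= ol w0 addn0 wl.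
by exists (OverpartitionPair pP); rewrite // mem_filter /= mem_enum.
Qed.

Lemma overpartitions_uniq n : uniq (overpartitions n).
Proof.
rewrite map_inj_in_uniq ?filter_uniq -?enumT ?enum_uniq // => p1 p2.
rewrite !mem_filter => /andP[/eqP e1 _] /andP[/eqP e2 _] e.
apply: val_inj; rewrite /= (surjective_pairing (opair p1)) e e1 -e2.
by rewrite -surjective_pairing.
Qed.

Lemma card_overpartition_pair n :
  #|{: overpartition_pair n}|
  = \sum_(i < n.+1) size (overpartitions i) * size (overpartitions (n - i)).
Proof.
rewrite -sum1_card (partition_big (fun p : overpartition_pair n =>
   inord (weight (opair p).1) : 'I_n.+1) xpredT) //=.
apply: eq_bigr => i _; rewrite sum1_card cardE -(size_map (@opair n)).
rewrite -(size_allpairs pair); apply/perm_size/uniq_perm.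
- by rewrite (map_inj_uniq val_inj) enum_uniq.
- by apply: allpairs_uniq; rewrite ?overpartitions_uniq // => -[? ?] [? ?].
case=> l m; apply/mapP/allpairsP => [[[p pP]]|[[l1 m1] /= [Hl Hm [-> ->]]]].
  rewrite mem_enum unfold_in /= => /eqP; have /and3P[o1 o2 /eqP w] := pP.
  move=> wi; have {wi}: weight p.1 = i by rewrite -wi inordK // ltnS -w leq_addr.
  move=> wi lm; subst p; move: o1 o2 w wi => /= o1 o2 w wi.
  exists (l, m); rewrite !mem_overpartitions /= o1 o2 wi.
  by rewrite (_ : n - i = weight m) ?eqxx // -wi -w addKn.
move: Hl Hm; rewrite !mem_overpartitions => /andP[ol /eqP wl] /andP[om /eqP wm].
have pP : is_overpartition_pair n (l1, m1).
  by rewrite /is_overpartition_pair /= ol om wl wm subnKC ?eqxx // -ltnS.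
exists (OverpartitionPair pP) => //.
by rewrite mem_enum unfold_in /= wl inord_val; apply: eqxx.
Qed.

(** What may follow a part of size [N]: all parts are at most [N] and none of
    size [N] is overlined.  Tails of overpartitions are of this form, so this
    family alone satisfies a recurrence.  Its generating function is the product
    of the 1 + X^k for k < N over that of the 1 - X^k for k <= N.  The
    flag [false] is arbitrary: [part_next] ignores it on the left. *)
Definition below (N n : nat) : nat :=
  count (path part_next (N, false)) (overpartitions n).

Lemma below0 n : below 0 n = (n == 0).
Proof.
rewrite /below -size_filter.
have -> : (n == 0 : nat) = size (nseq (n == 0) ([::] : seq (nat * bool))).
  by rewrite size_nseq.
apply/perm_size/uniq_perm; first by rewrite filter_uniq ?overpartitions_uniq.
  by case: (n == 0).
move=> l; rewrite mem_filter mem_overpartitions mem_nseq.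
case: l => [|[k c] l]; first by rewrite /weight big_nil; case: n.
rewrite andbF /is_overpartition /= {1}/part_next /=.
by case: k => [|k]; rewrite ?ltn0 ?andbF.
Qed.

(** Removing the first part is a bijection onto the overpartitions of [n - k]
    that may follow a part of size [k]. *)
Lemma count_overpartitions_cons k c n : 0 < k ->
  count (fun l => ohead l == Some (k, c)) (overpartitions n)
  = if k <= n then below k (n - k) else 0.
Proof.
move=> k_gt0; rewrite /below -size_filter.
case: leqP => [kn|nk]; last first.
  apply/eqP; rewrite size_filter -leqn0 leqNgt -has_count; apply/hasPn.
  move=> [|[j b] l]; rewrite ?mem_overpartitions // => /andP[_ wl].
  apply/eqP => -[e _]; move: wl; rewrite /weight big_cons /= e.
  by move/eqP=> e'; rewrite -e' ltnNge leq_addr in nk.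
rewrite -size_filter -[RHS](size_map (cons (k, c))).
apply/perm_size/uniq_perm.
- by rewrite filter_uniq ?overpartitions_uniq.
- by rewrite map_inj_uniq ?filter_uniq ?overpartitions_uniq // => l m [].
move=> l; rewrite mem_filter mem_overpartitions.
have tailE m : ((k, c) :: m \in [seq (k, c) :: i | i <- overpartitions (n - k)
    & path part_next (k, false) i])
    = is_overpartition ((k, c) :: m) && (weight ((k, c) :: m) == n).
  rewrite (mem_map (f := cons (k, c))) => [|? ? [] //].
  rewrite mem_filter mem_overpartitions /is_overpartition /= k_gt0.
  have -> : (weight m == n - k) = (weight ((k, c) :: m) == n).
    by rewrite /weight big_cons /=; apply/eqP/eqP; lia.
  have -> : path part_next (k, c) m = path part_next (k, false) m by case: m.
  have sortedW : path part_next (k, false) m -> sorted part_next m.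
    exact: path_sorted.
  by case: (path _ _ _) sortedW => [->|_]; rewrite ?andbT ?andbF.
case: l => [|x l] /=; first by apply/esym/mapP => -[].
case: eqP => [[->]|ne]; first by rewrite tailE.
by apply/esym/mapP => -[? _ [e _]]; rewrite e in ne.
Qed.

Lemma count_add3 (T : eqType) (P P1 P2 P3 : pred T) (s : seq T) :
  {in s, forall x, P x = P1 x + P2 x + P3 x :> nat} ->
  count P s = count P1 s + count P2 s + count P3 s.
Proof.
move=> PE; rewrite -!sum1_count ![\sum_(_ <- _ | _) _]big_mkcond -!big_split /=.
rewrite big_seq [RHS]big_seq; apply: eq_bigr => x /PE.
by do 4!case: ifP => _.
Qed.

(** Classify by the first part: besides the lists already allowed after [N],
    one may start with an overlined [N] or with a plain [N.+1].  For [N = 0]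
    the overlined case disappears because parts are positive. *)
Lemma belowS N n :
  below N.+1 n = below N n
    + (if (0 < N) && (N <= n) then below N (n - N) else 0)
    + (if N.+1 <= n then below N.+1 (n - N.+1) else 0).
Proof.
rewrite -(@count_overpartitions_cons N.+1 false) //.
have -> : (if (0 < N) && (N <= n) then below N (n - N) else 0) =
    count (fun l => ohead l == Some (N, true)) (overpartitions n).
  case: (posnP N) => [->|N_gt0] /=; last by rewrite count_overpartitions_cons.
  apply/esym/eqP; rewrite -leqn0 leqNgt -has_count; apply/hasPn.
  move=> [|[j b] l] //; rewrite mem_overpartitions => /andP[/andP[/= H _] _].
  by apply/eqP => -[e _]; rewrite e in H.
apply: count_add3 => l; rewrite mem_overpartitions => /andP[/andP[_ sl] _].
case: l sl => [|[k c] l] //= sl; rewrite sl !andbT /part_next /=.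
rewrite !(inj_eq Some_inj) !xpair_eqE.
move: {sl} c => [] /=; rewrite ?andbT ?andbF; lia.
Qed.

Lemma below_size N n : n < N -> below N n = size (overpartitions n).
Proof.
move=> nN; rewrite -(count_predT (overpartitions n)).
apply: eq_in_count => -[|[k c] l] //.
rewrite mem_overpartitions => /andP[/andP[_ /= ->]].
rewrite /weight big_cons /= andbT => /eqP w.
by rewrite /part_next /= (leq_ltn_trans _ nN) // -w leq_addr.
Qed.

(** * The generating function modulo a power of X *)

Section OverpartitionSeries.
Local Open Scope ring_scope.
Variable F : fieldType.

Lemma dvdp_XnP (M : nat) (p : {poly F}) :
  reflect (forall i, (i < M)%N -> p`_i = 0) ('X^M %| p).
Proof.
apply: (iffP idP) => [/dvdpP[r ->] i iM|p0]; first by rewrite coefMXn iM.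
apply/dvdpP; exists (drop_poly M p); rewrite -[LHS](poly_take_drop M).
suff -> : take_poly M p = 0 by rewrite add0r.
by apply/polyP => i; rewrite coef_take_poly coef0; case: ifP => [/p0|].
Qed.

Definition below_poly (M N : nat) : {poly F} := \poly_(i < M) (below N i)%:R.

Lemma below_polyS M N :
  ('X^M : {poly F}) %| (1 - 'X^(N.+1)) * below_poly M N.+1
          - (1 + 'X^N *+ (0 < N)%N) * below_poly M N.
Proof.
apply/dvdp_XnP => i iM.
rewrite mulrBl mulrDl !mul1r mulrnAl !coefB coefD coefMn !coefXnM.
rewrite !coef_poly iM !(leq_ltn_trans (leq_subr _ _) iM) belowS !natrD.
rewrite [(i < N.+1)%N]ltnS.
case: (ltnP N i) => _; case: (ltnP i N) => _; case: (0 < N)%N => /=; ring.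
Qed.

Lemma below_poly_pochhammer M N : (0 < M)%N ->
  ('X^M : {poly F}) %| qpoch_minus 'X N.+1 * below_poly M N.+1 - qpoch_plus 'X N.
Proof.
move=> M_gt0; have below_poly0 : below_poly M 0 = 1.
  apply/polyP => i; rewrite coef_poly coef1 below0.
  by case: ltnP => // Mi; rewrite gtn_eqF // (leq_trans M_gt0).
elim: N => [|N IHN].
  have := below_polyS M 0; rewrite below_poly0 qpoch_minusS.
  rewrite /qpoch_minus /qpoch_plus !big_ord0 /= mulr0n => d.
  by refine (etrans _ d); congr (_ %| _); ring.
have d := dvdp_add (dvdp_mull (qpoch_minus 'X N.+1) (below_polyS M N.+1))
                 (dvdp_mull (1 + 'X^(N.+1)) IHN).
refine (etrans _ d); congr (_ %| _).
by rewrite [qpoch_minus _ N.+2]qpoch_minusS qpoch_plusS /= mulr1n; ring.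
Qed.

(** The product formula for the series and Gauss's identity combine after
    cancelling [qpoch_minus], which is invertible modulo [X^M] because its
    constant coefficient is 1. *)
Lemma overpartition_series_theta M : (0 < M)%N ->
  ('X^M : {poly F})
    %| (\poly_(i < M) (size (overpartitions i))%:R) * theta 'X M - 1.
Proof.
move=> M_gt0; set P := \poly_(i < M) _.
have -> : P = below_poly M M.+1.
  apply/polyP => i; rewrite !coef_poly; case: ltnP => // iM.
  by rewrite below_size // ltnW.
have cop : coprimep 'X^M (qpoch_minus ('X : {poly F}) M.+1).
  rewrite coprimep_expl // coprimep_sym coprimepX /root /qpoch_minus horner_prod.
  by rewrite big1 ?oner_eq0 // => k _; rewrite !hornerE expr0n subr0.
rewrite -(Gauss_dvdpr _ cop).
have [c eq_theta] := gauss_mod ('X : {poly F}) M.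
(* The second multiple of ['X^M] collects the error term of Gauss's identity
   and the factor by which [qpoch_minus] changes from [M] to [M.+1]. *)
have d := dvdp_add (dvdp_mull (theta 'X M) (below_poly_pochhammer M M_gt0))
  (dvdp_mull ((c + qpoch_minus 'X M) * 'X) (dvdpp 'X^M)).
refine (etrans _ d); congr (_ %| _); apply/eqP; rewrite -subr_eq0; apply/eqP.
move/eqP: eq_theta; rewrite -subr_eq0 => /eqP <-.
by rewrite qpoch_minusS exprSr; ring.
Qed.

(** Squares are never 2 modulo 3. *)
Lemma coef_theta_mod3 M i : (i %% 3 = 2)%N -> (theta ('X : {poly F}) M)`_i = 0.
Proof.
move=> i3; have i_neq0 : (i == 0)%N = false by case: i i3.
rewrite /theta coefD coef1 i_neq0 coefMn coef_sum big1 ?mul0rn ?addr0 // => s _.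
rewrite -polyC1 -polyCN -rmorphXn coefCM coefXn.
case: eqP => [e|]; last by rewrite mulr0.
have := ltn_pmod s.+1 (isT : 0 < 3)%N.
by move: i3; rewrite e -modnXm; case: (s.+1 %% 3)%N => [|[|[|]]].
Qed.

(** In characteristic 3 cubing is additive, so it only moves [X^j] to [X^(3j)]
    and cubes the coefficients. *)
Lemma coef_cube_mod3 (p : {poly F}) i :
  3%N \in [pchar F] -> (i %% 3 != 0)%N -> (p ^+ 3)`_i = 0.
Proof.
move=> char3 i3.
have char3p : 3%N \in [pchar {poly F}] by rewrite pchar_poly.
rewrite -(pFrobenius_autE char3p) -[p]coefK poly_def rmorph_sum coef_sum big1 //.
move=> j _; rewrite /= pFrobenius_autE exprZn -exprM coefZ coefXn.
case: eqP => [e|]; last by rewrite mulr0.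
by rewrite e modnMl in i3.
Qed.

End OverpartitionSeries.

(** * Pairs modulo 3 *)

(** The count is the coefficient of [X^n] in [P^2], which equals [P^3 * theta]
    up to order [n]; in each product of coefficients, either the exponent from
    [P^3] is prime to 3 or the one from [theta] is 2 modulo 3. *)
Lemma card_overpartition_pair_mod3 n :
  n %% 3 = 2 -> 3 %| #|{: overpartition_pair n}|.
Proof.
move=> n3; rewrite card_overpartition_pair.
have char3 : 3 \in [pchar 'F_3]%R by apply: pchar_Fp.
rewrite (dvdn_pcharf char3) natr_sum.
pose P : {poly 'F_3} := (\poly_(i < n.+1) (size (overpartitions i))%:R)%R.
have -> : (\sum_(i < n.+1) (size (overpartitions i) *
    size (overpartitions (n - i)))%:R)%R = ((P ^+ 2)`_n)%R :> 'F_3.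
  rewrite expr2 coefM; apply: eq_bigr => i _.
  by rewrite !coef_poly ltn_ord ltnS leq_subr natrM.
have := dvdp_mull (P ^+ 2)%R (overpartition_series_theta 'F_3 (ltn0Sn n)).
move=> /dvdp_XnP /(_ n (ltnSn n)).
rewrite mulrBr mulr1 mulrA -exprSr coefB => /eqP; rewrite subr_eq0 => /eqP <-.
rewrite coefM big1 // => i _.
have [i3|i3] := eqVneq (i %% 3) 0; last by rewrite coef_cube_mod3 ?mul0r.
rewrite coef_theta_mod3 ?mulr0 //.
by have := ltn_ord i; lia.
Qed.

Lemma R2_swap (s t : int) n : R2 (- s)%R t n = R2 s t n.
Proof.
have swapP (p : overpartition_pair n) :
    is_overpartition_pair n ((opair p).2, (opair p).1).
  by case: p => p /and3P[/= o1 o2 w]; apply/and3P; rewrite /= addnC.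
pose swap p := OverpartitionPair (swapP p).
have swapK : involutive swap.
  by move=> p; apply: val_inj => /=; case: (opair p).
rewrite /R2 -(card_preimset _ (can_inj swapK)); apply: eq_card => p.
rewrite !inE /r2 /=; set a := n2 _; set b := n2 _.
by rewrite !eqz_mod_dvd !dvdzE -(abszN (_ - s)%R); congr (_ %| `|_|); ring.
Qed.

Lemma R2_total n : R2 0 3 n + R2 1 3 n + R2 2 3 n = #|{: overpartition_pair n}|.
Proof.
rewrite /R2 -!sum1_card ![\sum_(_ in [set _ | _]) _]big_mkcond -!big_split /=.
apply: eq_bigr => p _; rewrite !inE; move: (r2 p) => r.
by case: eqP; case: eqP; case: eqP; lia.
Qed.

Theorem theorem3p2 (n : nat) :
  R2 0 3 (3 * n + 2) = R2 1 3 (3 * n + 2) %[mod 3] /\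
  R2 1 3 (3 * n + 2) = R2 2 3 (3 * n + 2) %[mod 3].
Proof.
have n3 : (3 * n + 2) %% 3 = 2 by lia.
have := card_overpartition_pair_mod3 n3; rewrite -R2_total.
have -> : R2 2 3 (3 * n + 2) = R2 1 3 (3 * n + 2).
  rewrite -R2_swap /R2; apply: eq_card => p; rewrite !inE; lia.
by split=> //; lia.
Qed.
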